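(* Let $R$ be a commutative ring with unity such that its co-maximal ideal graph $\Gamma(R)$ is a finite graph. If $\Gamma(R)$ is planar, then one of the following holds: (i) $R\cong R_1\times R_2$, where $R_1$ and $R_2$ are local rings and one of the rings $R_1, R_2$ has at most three ideals; (ii) $R\cong R_1\times R_2\times R_3$, where $R_1,R_2,R_3$ are rings and each $R_i$ has at most one non-trivial ideal.
   Context: All rings are commutative with unity. ${\rm Max}(R)$ denotes the set of maximal ideals of $R$ and ${\rm J}(R)$ the Jacobson radical of $R$. A ring $R$ is called local if $|{\rm Max}(R)|=1$. The co-maximal ideal graph $\Gamma(R)$ is the graph whose vertices are the proper ideals of $R$ which are not contained in ${\rm J}(R)$, and two (distinct) vertices $I_1$ and $I_2$ are adjacent if and only if $I_1+I_2=R$. A graph is finite if it has finitely many vertices, and planar if it can be drawn in the plane so that its edges intersect only at their ends. When counting the ideals of a ring, the zero ideal and the whole ring are included; a non-trivial ideal is an ideal different from the zero ideal and from the whole ring.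
   Formalization: The formal theorem assumes in addition that the co-maximal ideal graph has at least one vertex (R is not local); for the local ring Z/8 the graph has no vertices and neither (i) nor (ii) holds. *)

(* Defs.v *)
From HB Require Import structures.
From mathcomp Require Import all_boot all_order all_algebra.
From mathcomp Require Import all_classical all_reals all_analysis.
Import GRing.Theory Num.Theory.
Import numFieldNormedType.Exports.

Set Implicit Arguments.
Unset Strict Implicit.
Unset Printing Implicit Defensive.

Local Open Scope classical_set_scope.
Local Open Scope card_scope.
Local Open Scope ring_scope.

(* Ideals are arbitrary subsets: the ideals of ring_quotient are decidable and,
   by definition, proper, whereas [set 0] and setT both count here. *)
Definition is_ideal (R : comNzRingType) (I : set R) : Prop :=
  [/\ I 0, forall x y, I x -> I y -> I (x + y) & forall a x, I x -> I (a * x)].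

Definition ideals (R : comNzRingType) : set (set R) := [set I | is_ideal I].
Arguments ideals R : clear implicits.

Definition proper_ideals (R : comNzRingType) : set (set R) :=
  [set I | is_ideal I /\ I <> setT].
Arguments proper_ideals R : clear implicits.

Definition nontrivial_ideals (R : comNzRingType) : set (set R) :=
  [set I | [/\ is_ideal I, I <> [set 0] & I <> setT]].
Arguments nontrivial_ideals R : clear implicits.

Definition maximal_ideals (R : comNzRingType) : set (set R) :=
  [set M | proper_ideals R M /\
           forall I, proper_ideals R I -> M `<=` I -> I = M].
Arguments maximal_ideals R : clear implicits.

Definition jacobson_radical (R : comNzRingType) : set R :=
  \bigcap_(M in maximal_ideals R) M.
Arguments jacobson_radical R : clear implicits.

Definition is_local (R : comNzRingType) : Prop := maximal_ideals R #= `I_1.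

Definition ideal_sum (R : comNzRingType) (I J : set R) : set R :=
  [set x + y | x in I & y in J].

Definition ring_isomorphic (R S : comNzRingType) : Prop :=
  exists f : {rmorphism R -> S}, bijective f.

(* A simple graph; an edge is the set of its two ends. *)
Record graph (T : Type) := Graph {
  vertices : set T;
  edges : set (set T);
  edges_ends : forall e, edges e ->
    exists u v, [/\ vertices u, vertices v, u <> v & e = [set u; v]]
}.

Definition finite_graph (T : Type) (G : graph T) : Prop :=
  finite_set (vertices G).

Definition is_arc (K : realType) (x y : K * K) (A : set (K * K)) : Prop :=
  exists f : K -> K * K,
    [/\ {within `[0, 1], continuous f}, set_inj `[0, 1] f,
        f 0 = x, f 1 = y & f @` `[0, 1] = A].

(* p gives the positions of the vertices and D e is the arc representing the
   edge e; the values of p and D outside the graph are irrelevant. *)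
Definition planar (K : realType) (T : Type) (G : graph T) : Prop :=
  exists (p : T -> K * K) (D : set T -> set (K * K)),
    [/\ set_inj (vertices G) p,
        forall u v, edges G [set u; v] -> is_arc (p u) (p v) (D [set u; v]),
        forall e w, edges G e -> vertices G w -> D e (p w) -> e w
      & forall e e', edges G e -> edges G e' -> e <> e' ->
          D e `&` D e' `<=` p @` (e `&` e')].

(* This set is empty when R is local. *)
Definition comaximal_vertices (R : comNzRingType) : set (set R) :=
  [set I | proper_ideals R I /\ ~ I `<=` jacobson_radical R].
Arguments comaximal_vertices R : clear implicits.

Definition comaximal_edges (R : comNzRingType) : set (set (set R)) :=
  [set e | exists I J : set R,
     [/\ comaximal_vertices R I /\ comaximal_vertices R J, I <> J,
         ideal_sum I J = setT & e = [set I; J]]].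
Arguments comaximal_edges R : clear implicits.

Lemma comaximal_edges_ends (R : comNzRingType) (e : set (set R)) :
  comaximal_edges R e -> exists u v,
    [/\ comaximal_vertices R u, comaximal_vertices R v, u <> v & e = [set u; v]].
Proof. by move=> [I [J [[VI VJ] neqIJ _ ->]]]; exists I, J. Qed.

Definition comaximal_graph (R : comNzRingType) : graph (set R) :=
  Graph (@comaximal_edges_ends R).

(* Main.v *)
Require Import Defs.
From HB Require Import structures.
From mathcomp Require Import all_boot all_order all_algebra.
From mathcomp Require Import all_classical all_reals all_analysis.
From mathcomp Require Import ring lra zify.
Import Order.TTheory GRing.Theory Num.Theory.
Import numFieldNormedType.Exports.

(* If M and M' are distinct maximal ideals, pick a in M with 1 - a in M'.
   The ideals generated by the powers of a are vertices, so two of them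
   coincide, and this produces an idempotent in M whose complement lies in
   M'. Hence R is a product of two local rings when it has two maximal
   ideals, and of three nonzero rings otherwise. A factor with two
   nontrivial ideals provides three proper ideals comaximal to every
   proper ideal coming from the other factors, so in each excluded case
   the graph contains K33.

   K33 is not planar, even with arbitrary continuous arcs: by compactness
   the arcs can be replaced by polygonal paths in such a way that
   independent edges (those without a common end) remain disjoint, and in
   a polygonal drawing the number of crossings between independent edges
   is odd. The latter follows from a formula for the crossing parity of
   the segments pq and rs as a sum of four terms telling whether an end of
   one segment is above or below the other: summed along paths, it only
   depends on the position of each path with respect to the ends of the
   other one, and summed over all independent pairs everything cancels
   except the order of the three vertices of one side. *)

Set Implicit Arguments.
Unset Strict Implicit.
Unset Printing Implicit Defensive.

Local Open Scope classical_set_scope.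
Local Open Scope card_scope.
Local Open Scope ring_scope.

(** * The crossing parity of polygonal paths *)

Section Plane.
Variable K : realFieldType.
Implicit Types p q r s u v : K * K.

Definition segment p q : set (K * K) :=
  [set z | exists2 t : K, 0 <= t <= 1 &
     z = (p.1 + t * (q.1 - p.1), p.2 + t * (q.2 - p.2))].

(** Twice the signed area of the triangle, positive when [r] is to the left of the line from [p] to
    [q]. *)
Definition orientation p q r : K :=
  (q.1 - p.1) * (r.2 - p.2) - (q.2 - p.2) * (r.1 - p.1).

Definition lexpos v : bool := (0 < v.1) || (v.1 == 0) && (0 < v.2).

(* The lexicographic order is the order of the abscissas after an infinitesimal
   shear, so vertical alignments need no general position assumption. *)
Definition lexlt p q : bool := lexpos (q - p).

Lemma lexposD u v : lexpos u -> lexpos v -> lexpos (u + v).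
Proof.
rewrite /lexpos /=.
move=> /orP[u1|/andP[/eqP u1 u2]] /orP[v1|/andP[/eqP v1 v2]].
- by rewrite addr_gt0.
- by rewrite v1 addr0 u1.
- by rewrite u1 add0r v1.
- by rewrite u1 v1 addr0 eqxx addr_gt0 ?orbT.
Qed.

Lemma lexposZ (a : K) v : 0 < a -> lexpos (a *: v) = lexpos v.
Proof.
move=> a0; rewrite /lexpos /= !pmulr_rgt0 //.
by rewrite mulf_eq0 (gt_eqF a0).
Qed.

Lemma lexposN v : lexpos v -> lexpos (- v) = false.
Proof.
move=> vp; apply/negP => /(lexposD vp).
by rewrite subrr /lexpos /= ltxx andbF.
Qed.

Lemma lexpos_total v : v != 0 -> lexpos v || lexpos (- v).
Proof.
case: v => v1 v2 v0; rewrite /lexpos /= !oppr_gt0 oppr_eq0.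
case: (ltgtP v1 0) => //= v10; rewrite orbC.
have : v2 != 0 by apply: contraNneq v0 => v20; apply/eqP; rewrite v10 v20.
by rewrite neq_lt.
Qed.

(** Reads the sign of a signed area off an affine dependency: a positive combination of positive
    vectors is positive, so it cannot be a nonpositive multiple of [w]. *)
Lemma lexpos_coef (a b c : K) u v w : 0 < a -> 0 < b ->
  lexpos u -> lexpos v -> lexpos w ->
  a * u.1 + b * v.1 = c * w.1 -> a * u.2 + b * v.2 = c * w.2 -> 0 < c.
Proof.
move=> a0 b0 u0 v0 w0 E1 E2.
have cw : lexpos (c *: w).
  have -> : c *: w = a *: u + b *: v by apply/esym/pair_equal_spec.
  by rewrite lexposD ?lexposZ.
case: (ltgtP c 0) => // c0.
  by move: cw; rewrite -[c]opprK scaleNr lexposN // lexposZ ?oppr_gt0.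
by move: cw; rewrite c0 scale0r /lexpos /= ltxx andbF.
Qed.

Lemma lexltN p q : p != q -> lexlt p q = ~~ lexlt q p.
Proof.
move=> pq; rewrite /lexlt -[p - q]opprB.
case: (boolP (lexpos (q - p))) => [/lexposN->//|/negbTE H].
have : q - p != 0 by rewrite subr_eq0 eq_sym.
by move/lexpos_total; rewrite H /= => ->.
Qed.

Lemma lexlt_asym p q : lexlt p q -> lexlt q p = false.
Proof. by rewrite /lexlt -[p - q]opprB => /lexposN. Qed.

Lemma lexlt_trans p q r : lexlt p q -> lexlt q r -> lexlt p r.
Proof. by rewrite /lexlt => H /(lexposD H); rewrite addrC subrKA. Qed.

Lemma lexltxx p : lexlt p p = false.
Proof. by rewrite /lexlt subrr /lexpos /= ltxx andbF. Qed.

(** A half-open interval: the smaller end is excluded and the larger one included, so consecutive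
    segments of a path fit together exactly. *)
Definition between p q s : bool := lexlt p s (+) lexlt q s.

(** Directing the line from its smaller end makes its right side the lower one. In [above], points
    of the line count as above. *)
Definition right_of p q s : bool :=
  if lexlt p q then orientation p q s < 0 else orientation q p s < 0.

Definition below p q s : bool := between p q s && right_of p q s.

Definition above p q s : bool := between p q s && ~~ right_of p q s.

(* The number of crossings, modulo 2, of two segments in general position. *)
Definition crossing_parity p q r s : bool :=
  above p q r (+) above p q s (+) below r s p (+) below r s q.

(** The correction term is a sum over the two ends, so it telescopes along a path. *)
Lemma aboveE p q s : above p q s = below p q s (+) (lexlt p s (+) lexlt q s).
Proof. by rewrite /above /below /between; case: right_of; case: (_ (+) _). Qed.

Lemma segment_start p q : segment p q p.
Proof. by exists 0; rewrite ?lexx ?ler01 // !mul0r !addr0; case: p. Qed.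

Lemma segment_end p q : segment p q q.
Proof.
exists 1; first by rewrite lexx ler01.
by rewrite !mul1r ![_ + (_ - _)]addrC !subrK; case: q.
Qed.

Lemma segmentC p q : segment p q = segment q p.
Proof.
by apply/seteqP; split=> _ [t t01 ->]; (exists (1 - t); first by lra);
  congr pair; ring.
Qed.

Lemma right_ofC p q s : right_of p q s = right_of q p s.
Proof.
rewrite /right_of; case: (eqVneq p q) => [->//|pq].
by rewrite (lexltN pq); case: (lexlt q p).
Qed.

Lemma betweenC p q s : between p q s = between q p s.
Proof. exact: addbC. Qed.

Lemma belowC p q s : below p q s = below q p s.
Proof. by rewrite /below betweenC right_ofC. Qed.

Lemma aboveC p q s : above p q s = above q p s.
Proof. by rewrite /above betweenC right_ofC. Qed.

(* Coordinatewise, [A s + C q = D p + B r] and [A + C = D + B]: the signed areas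
   are the coefficients of the affine dependency between the four points. *)
Lemma affine_dependency p q r s (a : K) :
  [/\ orientation p q r * (s.1 - a) + orientation r s p * (q.1 - a) =
      orientation r s q * (p.1 - a) + orientation p q s * (r.1 - a),
      orientation p q r * (s.2 - a) + orientation r s p * (q.2 - a) =
      orientation r s q * (p.2 - a) + orientation p q s * (r.2 - a)
    & orientation p q r + orientation r s p =
      orientation r s q + orientation p q s].
Proof. by rewrite /orientation; split; ring. Qed.

(** The common point divides each segment in the ratio of the signed areas at its ends. By the
    affine dependency, both parameters have the same denominator up to sign. *)
Lemma segments_meet p q r s :
  orientation p q r * orientation p q s < 0 ->
  orientation r s p * orientation r s q < 0 ->
  segment p q `&` segment r s !=set0.
Proof.
set A := orientation p q r; set B := orientation p q s.
set C := orientation r s p; set D := orientation r s q.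
have [_ _ ABCD] := affine_dependency p q r s 0.
rewrite -/A -/B -/C -/D in ABCD.
move=> AB CD.
have AB0 : A - B != 0 by nra.
have CDE : C - D = - (A - B) by lra.
have CD0 : C - D != 0 by rewrite CDE oppr_eq0.
exists (r.1 + A / (A - B) * (s.1 - r.1), r.2 + A / (A - B) * (s.2 - r.2)).
have frac (x y : K) : x * y < 0 -> 0 <= x / (x - y) <= 1.
  case: (ltgtP x 0) => x0 xy; last by nra.
  - have y0 : 0 < y by nra.
    rewrite -mulrNN -invrN opprB divr_ge0 ?ler_pdivrMr; lra.
  - have y0 : y < 0 by nra.
    by rewrite divr_ge0 ?ler_pdivrMr; lra.
split; last by exists (A / (A - B)) => //; exact: frac.
exists (C / (C - D)); first exact: frac.
have E : C / (C - D) = - C / (A - B) by rewrite CDE invrN mulrN mulNr.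
rewrite E.
have clear_den n x w : (A - B) * (x + n / (A - B) * w) = (A - B) * x + n * w.
  by field.
by congr pair; apply: (mulfI AB0); rewrite !clear_den /A /B /C /orientation;
  ring.
Qed.

Lemma collinear_segment p q r : lexlt p r -> lexlt r q ->
  orientation p q r = 0 -> segment p q r.
Proof.
case: p q r => [p1 p2] [q1 q2] [r1 r2] pr rq.
have pq := lexlt_trans pr rq.
move: pr rq pq; rewrite /lexlt /lexpos /orientation /= !subr_gt0 !subr_eq0.
move=> pr rq pq o0.
have [pq1|pq1] := ltP p1 q1.
  have d0 : q1 - p1 != 0 by lra.
  exists ((r1 - p1) / (q1 - p1)).
    rewrite divr_ge0 ?ler_pdivrMr /=; lra.
  congr pair => /=; first by field.
  by rewrite mulrAC [_ * (q2 - p2)]mulrC -(subr0_eq o0); field.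
(* On a vertical line the lexicographic order compares ordinates, which then give the parameter. *)
have /eqP E1 : q1 == p1 by lra.
have /eqP E2 : r1 == p1 by lra.
have pq2 : p2 < q2 by lra.
have d0 : q2 - p2 != 0 by lra.
exists ((r2 - p2) / (q2 - p2)).
  rewrite divr_ge0 ?ler_pdivrMr /=; lra.
by congr pair => /=; rewrite ?E1 ?E2; field.
Qed.

(** As [p] comes first, only the place of [q] relative to [r] and [s] matters. An odd parity would
    prescribe the signs of two of the four signed areas; the affine dependency then forces the other
    two, and the segments meet. *)
Lemma parity_ordered p q r s : segment p q `&` segment r s = set0 ->
  lexlt p q -> lexlt r s -> lexlt p r -> crossing_parity p q r s = false.
Proof.
move=> disj pq rs pr.
have neq x y : segment p q x -> segment r s y -> x != y.
  move=> px ry; apply/eqP => xy; have : (segment p q `&` segment r s) x.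
    by split=> //; rewrite xy.
  by rewrite disj.
have rp : lexlt r p = false by exact: lexlt_asym.
have ps := lexlt_trans pr rs.
have sp : lexlt s p = false by exact: lexlt_asym.
have qr : q != r by apply: neq; [exact: segment_end|exact: segment_start].
have qs : q != s by apply: neq; exact: segment_end.
rewrite /crossing_parity /above /below /between /right_of pq rs rp sp pr ps.
rewrite (lexltN qr) (lexltN qs).
have ndisj : ~ (segment p q `&` segment r s !=set0).
  by rewrite disj => -[].
have := @segments_meet p q r s; have := affine_dependency p q r s.
set A := orientation p q r; set B := orientation p q s.
set C := orientation r s p; set D := orientation r s q.
move=> dep meet.
(* If [q] precedes [r], no end lies between the ends of the other segment and all four terms
   vanish. *)
case: (boolP (lexlt r q)) => rq; last first.
  have qr' : lexlt q r by rewrite (lexltN qr).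
  by rewrite (lexlt_asym (lexlt_trans qr' rs)).
have A0 : A != 0.
  apply/eqP => /(collinear_segment pr rq) pqr.
  by have := neq r r pqr (segment_start r s); rewrite eqxx.
case: (boolP (lexlt s q)) => sq.
- have B0 : B != 0.
    apply/eqP => /(collinear_segment ps sq) pqs.
    by have := neq s s pqs (segment_end r s); rewrite eqxx.
  rewrite /=; case: (ltgtP A 0) A0 => // A0 _; case: (ltgtP B 0) B0 => // B0 _.
  + exfalso; apply/ndisj/meet; first by nra.
    have D0 : 0 < - D.
      (* With [q] as base point the term in [C] disappears from the dependency, and the other three
         points precede [q]. *)
      have [E1 _ _] := dep q.1; have [_ E2 _] := dep q.2.
      by apply: (@lexpos_coef B (- A) _ (q - r) (q - s) (q - p)) => //=; lra.
    have C0 : 0 < C.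
      have [E1 _ _] := dep p.1; have [_ E2 _] := dep p.2.
      by apply: (@lexpos_coef B (- A) _ (r - p) (s - p) (q - p)) => //=; lra.
    by nra.
  + exfalso; apply/ndisj/meet; first by nra.
    have D0 : 0 < D.
      have [E1 _ _] := dep q.1; have [_ E2 _] := dep q.2.
      by apply: (@lexpos_coef (- B) A _ (q - r) (q - s) (q - p)) => //=; lra.
    have C0 : 0 < - C.
      have [E1 _ _] := dep p.1; have [_ E2 _] := dep p.2.
      by apply: (@lexpos_coef (- B) A _ (r - p) (s - p) (q - p)) => //=; lra.
    by nra.
have {}qs : lexlt q s by rewrite (lexltN qs).
have D0 : D != 0.
  apply/eqP => /(collinear_segment rq qs) rsq.
  by have := neq q q (segment_end p q) rsq; rewrite eqxx.
rewrite /=; case: (ltgtP A 0) A0 => // A0 _; case: (ltgtP D 0) D0 => // D0 _.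
- exfalso; apply/ndisj/meet.
    have B0 : 0 < B; last by nra.
    have [E1 _ _] := dep q.1; have [_ E2 _] := dep q.2.
    by apply: (@lexpos_coef (- A) (- D) _ (s - q) (q - p) (q - r)) => //=; lra.
  have C0 : 0 < C; last by nra.
  have [E1 _ _] := dep r.1; have [_ E2 _] := dep r.2.
  by apply: (@lexpos_coef (- A) (- D) _ (s - r) (r - p) (q - r)) => //=; lra.
- exfalso; apply/ndisj/meet.
    have B0 : 0 < - B; last by nra.
    have [E1 _ _] := dep q.1; have [_ E2 _] := dep q.2.
    by apply: (@lexpos_coef A D _ (s - q) (q - p) (q - r)) => //=; lra.
  have C0 : 0 < - C; last by nra.
  have [E1 _ _] := dep r.1; have [_ E2 _] := dep r.2.
  by apply: (@lexpos_coef A D _ (s - r) (r - p) (q - r)) => //=; lra.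
Qed.

Lemma crossing_parityCl p q r s :
  crossing_parity q p r s = crossing_parity p q r s.
Proof. by rewrite /crossing_parity !(aboveC q p) addbAC. Qed.

Lemma crossing_parityCr p q r s :
  crossing_parity p q s r = crossing_parity p q r s.
Proof. by rewrite /crossing_parity !(belowC s r) (addbC (above p q s)). Qed.

(** Rewriting [above] through [below], the two sides differ by four comparisons, each replaced by
    its negation since the ends are distinct; four negations cancel modulo 2. *)
Lemma crossing_parity_sym p q r s : segment p q `&` segment r s = set0 ->
  crossing_parity r s p q = crossing_parity p q r s.
Proof.
move=> disj.
have neq x y : segment p q x -> segment r s y -> y != x.
  move=> px ry; apply/eqP => yx; have : (segment p q `&` segment r s) x.
    by split=> //; rewrite -yx.
  by rewrite disj.
rewrite /crossing_parity !aboveE.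
rewrite (lexltN (neq p r _ _)) ?(lexltN (neq p s _ _)) ?(lexltN (neq q r _ _))
  ?(lexltN (neq q s _ _)); do ?[exact: segment_start|exact: segment_end].
move: (below p q r) (below p q s) (below r s p) (below r s q).
move: (lexlt p r) (lexlt q r) (lexlt p s) (lexlt q s).
by do 8!case.
Qed.

Lemma crossing_parity_degenerate p r s : crossing_parity p p r s = false.
Proof. by rewrite /crossing_parity /above /between !addbb. Qed.

(** By symmetry each segment starts at its smaller end, and the segment that starts first is listed
    first. *)
Lemma crossing_parity_disjoint p q r s :
  segment p q `&` segment r s = set0 -> crossing_parity p q r s = false.
Proof.
move=> disj.
wlog pq : p q disj / lexlt p q => [ih|].
  have [->|pq] := eqVneq p q; first exact: crossing_parity_degenerate.
  case: (boolP (lexlt p q)) => [/ih->//|]; rewrite (lexltN pq) negbK => qp.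
  by rewrite -crossing_parityCl ih // segmentC.
wlog rs : r s disj / lexlt r s => [ih|].
  have [rs|rs] := eqVneq r s.
    by rewrite -crossing_parity_sym // rs crossing_parity_degenerate.
  case: (boolP (lexlt r s)) => [/ih->//|]; rewrite (lexltN rs) negbK => sr.
  by rewrite -crossing_parityCr ih // [segment s r]segmentC.
case: (boolP (lexlt p r)) => pr; first exact: parity_ordered.
rewrite -crossing_parity_sym //; apply: parity_ordered; rewrite 1?setIC //.
rewrite lexltN //; apply/eqP => rp; have : (segment p q `&` segment r s) p.
  by split; [|rewrite -rp]; exact: segment_start.
by rewrite disj.
Qed.

Definition path_below (c : nat -> K * K) n s : bool :=
  \big[addb/false]_(k < n) below (c k) (c k.+1) s.

Definition path_above (c : nat -> K * K) n s : bool :=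
  \big[addb/false]_(k < n) above (c k) (c k.+1) s.

Lemma path_aboveE c n s :
  path_above c n s = path_below c n s (+) (lexlt (c 0%N) s (+) lexlt (c n) s).
Proof.
rewrite /path_above /path_below; elim: n => [|n ih].
  by rewrite !big_ord0 addbb.
rewrite !big_ord_recr /= ih aboveE.
move: (\big[_/_]_(_ < _) _) (below _ _ _).
move: (lexlt _ s) (lexlt (c n) s) (lexlt _ s).
by do 5!case.
Qed.

(** When the parities are added along [d], each interior vertex contributes the same [above] term
    twice. [path_parity] repeats this along the other path. *)
Lemma path_parity_segment p q (d : nat -> K * K) n :
  (forall l, (l < n)%N -> segment p q `&` segment (d l) (d l.+1) = set0) ->
  above p q (d 0%N) (+) above p q (d n) (+) path_below d n p (+)
  path_below d n q = false.
Proof.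
rewrite /path_below; elim: n => [|n ih] disj.
  by rewrite !big_ord0 addbb.
rewrite !big_ord_recr /=.
have {}ih := ih (fun l ln => disj l (ltnW ln)).
have := crossing_parity_disjoint (disj n (ltnSn n)).
rewrite /crossing_parity; move: ih.
move: (\big[_/_]_(_ < n) _) (\big[_/_]_(_ < n) _) (below _ _ p) (below _ _ q).
move: (above p q (d 0%N)) (above p q (d n)) (above p q (d n.+1)).
by do 7!case.
Qed.

Lemma path_parity (c d : nat -> K * K) m n :
  (forall k l, (k < m)%N -> (l < n)%N ->
     segment (c k) (c k.+1) `&` segment (d l) (d l.+1) = set0) ->
  path_above c m (d 0%N) (+) path_above c m (d n) (+)
  path_below d n (c 0%N) (+) path_below d n (c m) = false.
Proof.
rewrite /path_above; elim: m => [|m ih] disj.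
  by rewrite !big_ord0 /= addbb.
rewrite !big_ord_recr /=.
have {}ih := ih (fun k l km => disj k l (ltnW km)).
have := path_parity_segment (fun l => disj m l (ltnSn m)).
move: ih; move: (\big[_/_]_(_ < m) _) (\big[_/_]_(_ < m) _).
move: (above _ _ (d 0%N)) (above _ _ (d n)).
move: (path_below d n (c 0%N)) (path_below d n (c m)) (path_below d n (c m.+1)).
by do 7!case.
Qed.

Lemma lexlt_add p q : p != q -> (lexlt p q + lexlt q p = 1)%N.
Proof. by move/lexltN->; case: lexlt. Qed.

(* Summed over the 18 pairs of independent edges of K33, each [path_below] term
   appears twice, and what remains only depends on the order of the vertices. *)
Lemma K33_crossing (a b : nat -> K * K) (c : nat -> nat -> nat -> K * K) n :
  (forall i j, (i < 3)%N -> (j < 3)%N -> c i j 0%N = a i /\ c i j n.+1 = b j) ->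
  ~ (forall i j k l, (i < 3)%N -> (j < 3)%N -> (k < 3)%N -> (l < 3)%N ->
       i <> k -> j <> l -> forall x y, (x < n.+1)%N -> (y < n.+1)%N ->
       segment (c i j x) (c i j x.+1) `&` segment (c k l y) (c k l y.+1)
       = set0).
Proof.
move=> ends disj.
have neq i j k l : (i < 3)%N -> (j < 3)%N -> (k < 3)%N -> (l < 3)%N ->
    i <> k -> j <> l -> a i != b l /\ b j != b l.
  move=> i3 j3 k3 l3 ik jl.
  have {}disj := disj i j k l i3 j3 k3 l3 ik jl.
  have [<- <-] := ends _ _ i3 j3; have [_ <-] := ends _ _ k3 l3.
  split; apply/eqP => e.
    have : set0 (c i j 0%N); last by [].
    rewrite -(disj 0%N n) //; split; first exact: segment_start.
    by rewrite e; exact: segment_end.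
  have : set0 (c i j n.+1); last by [].
  rewrite -(disj n n) //; split; first exact: segment_end.
  by rewrite e; exact: segment_end.
(* Booleans become natural numbers so that the final cancellation is linear arithmetic. *)
pose B i j v : nat := path_below (c i j) n.+1 v.
pose L p q : nat := lexlt p q.
pose T i j k l := (B i j (a k) + (L (a i) (a k) + L (b j) (a k)) +
  (B i j (b l) + (L (a i) (b l) + L (b j) (b l))) +
  B k l (a i) + B k l (b j))%N.
have evenT i j k l : (i < 3)%N -> (j < 3)%N -> (k < 3)%N -> (l < 3)%N ->
    i <> k -> j <> l -> ~~ odd (T i j k l).
  move=> i3 j3 k3 l3 ik jl.
  have := path_parity (disj i j k l i3 j3 k3 l3 ik jl).
  have [e1 e2] := ends _ _ i3 j3; have [e3 e4] := ends _ _ k3 l3.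
  by rewrite !path_aboveE e1 e2 e3 e4 /T /B /L !oddD !oddb => ->.
(* Increasing pairs on the side [a] and ordered pairs on the side [b] list each of the 18
   independent pairs of edges once. *)
pose s1 := [:: (0, 1); (0, 2); (1, 2)]%N.
pose s2 := [:: (0, 1); (1, 0); (0, 2); (2, 0); (1, 2); (2, 1)]%N.
pose ok (x : nat * nat) := [&& x.1 < 3, x.2 < 3 & x.1 != x.2]%N.
have s1P : all ok s1 by [].
have s2P : all ok s2 by [].
have odd0 x y : ~~ odd x -> ~~ odd y -> ~~ odd (x + y).
  by rewrite oddD; case: odd; case: odd.
have : ~~ odd (\sum_(x <- s1) \sum_(y <- s2) T x.1 y.1 x.2 y.2).
  rewrite big_seq; apply: (big_ind (fun m => ~~ odd m)) => // x.
  move=> /(allP s1P)/and3P[x1 x2 /eqP x12].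
  rewrite big_seq; apply: (big_ind (fun m => ~~ odd m)) => // y.
  by move=> /(allP s2P)/and3P[y1 y2 /eqP y12]; exact: evenT.
set t := (\sum_(_ <- _) _)%N => ev.
have tE : t = (t./2 + t./2)%N by rewrite addnn even_halfK.
have bL i j : (i < 3)%N -> (j < 3)%N -> i <> j ->
    (L (b i) (b j) + L (b j) (b i) = 1)%N.
  move=> i3 j3 ij; apply: lexlt_add.
  by have [] := neq 0%N i 1%N j isT i3 isT j3.
have b01 := bL 0%N 1%N isT isT.
have b02 := bL 0%N 2%N isT isT.
have b12 := bL 1%N 2%N isT isT.
have abL i j : (i < 3)%N -> (j < 3)%N -> (L (a i) (b j) + L (b j) (a i) = 1)%N.
  move=> i3 j3; apply: lexlt_add.
  (* Any indices below 3 other than [i] and [j] would do: they make the edges from [a i] to [b l]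
     and from [a k] to [b j] independent. *)
  pose k := (i == 0)%N : nat; pose l := (j == 0)%N : nat.
  have [] // := neq i l k j i3 _ _ j3; rewrite /k /l; first by case: (j).
  - by case: (i).
  - by case: (i) => // -[].
  - by case: (j) => // -[].
move: tE b01 b02 b12 (abL 0%N 0%N) (abL 0%N 1%N) (abL 0%N 2%N)
  (abL 1%N 0%N) (abL 1%N 1%N) (abL 1%N 2%N)
  (abL 2%N 0%N) (abL 2%N 1%N) (abL 2%N 2%N).
(* Each of the six comparisons among the [b j] occurs three times, which adds up to 9; all other
   terms occur an even number of times. *)
rewrite {1}/t !big_cons !big_nil /T /=.
move: (t./2) => h; clear.
lia.
Qed.

End Plane.

(** * Polygonal approximation of arcs *)

Section Arcs.
Variable K : realType.

(** The property [Q] takes the scale as an argument so that the lemma can be nested, once for each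
    of two arcs. *)
Lemma lebesgue_number (a b : K) (Q : K -> K -> K -> Prop) :
  (forall d e x y : K, 0 < d -> d <= e -> Q e x y -> Q d x y) ->
  (forall z : K, a <= z <= b -> exists2 d : K, 0 < d & forall x y : K,
     a <= x <= b -> a <= y <= b -> `|x - z| < d -> `|y - z| < d -> Q d x y) ->
  exists2 d : K, 0 < d & forall x y : K,
     a <= x <= b -> a <= y <= b -> `|x - y| < d -> Q d x y.
Proof.
move=> mono local.
have tri (x y z d e : K) : 0 < d -> e < d / 2 -> `|x - z| < d / 2 ->
    `|x - y| < e -> [/\ e <= d, `|x - z| < d & `|y - z| < d].
  move=> d0 ed xz xy; have : `|y - z| <= `|x - y| + `|x - z|.
    by rewrite [`|x - y|]distrC -[y - z](subrKA x) ler_normD.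
  by split; lra.
have := @segment_compact K a b.
move=> /compact_near_coveringP/near_covering_withinP cover.
have : \forall d \near 0^'+, `[a, b] `<=`
    [set x | forall y, a <= y <= b -> `|x - y| < d -> Q d x y].
  apply: cover => /= z; rewrite /= in_itv /= => zab.
  have [d d0 Qd] := local z zab.
  near=> x e; rewrite /= in_itv /= => xab y yab xy.
  have e0 : 0 < e by near: e; exact: nbhs_right_gt.
  have ed : e < d / 2 by near: e; apply: nbhs_right_lt; rewrite divr_gt0.
  have xz : `|x - z| < d / 2.
    rewrite distrC; near: x; apply: nbhsx_ballx; by rewrite divr_gt0.
  have [ed' xz' yz'] := tri _ _ _ _ _ d0 ed xz xy.
  by apply: (mono _ d) => //; exact: Qd.
move=> covered; near (0 : K)^'+ => d.
exists d => [|x y xab]; first by near: d; exact: nbhs_right_gt.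
have : `[a, b] `<=` [set x | forall y, a <= y <= b -> `|x - y| < d -> Q d x y].
  by near: d; exact: covered.
by apply; rewrite /= in_itv.
Unshelve. all: by end_near. Qed.

(** Balls of the product are open boxes, hence convex, and the two boxes are disjoint because one
    coordinate of their centres differs by at least [2 * e]. *)
Lemma segment_disjoint (p q r s u v : K * K) e :
  2 * e <= `|u.1 - v.1| \/ 2 * e <= `|u.2 - v.2| ->
  ball u e p -> ball u e q -> ball v e r -> ball v e s ->
  segment p q `&` segment r s = set0.
Proof.
have conv (a b x t : K) : `|x - a| < e -> `|x - b| < e -> 0 <= t <= 1 ->
    `|a + t * (b - a) - x| < e.
  rewrite !ltr_norml => /andP[a1 a2] /andP[b1 b2] /andP[t0 t1].
  have [t_gt0|t_le0] := ltP 0 t; last by apply/andP; split; nra.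
  have [] : 0 < t * (e - (b - x)) /\ 0 < t * (e + (b - x)).
    by split; apply: mulr_gt0; lra.
  have [] : 0 <= (1 - t) * (e - (a - x)) /\ 0 <= (1 - t) * (e + (a - x)).
    by split; apply: mulr_ge0; lra.
  by move=> *; apply/andP; split; lra.
move=> uv [p1 p2] [q1 q2] [r1 r2] [s1 s2].
apply/seteqP; split=> // _ [[t t01 ->] [t' t'01 [e1 e2]]].
have {p1 q1} := conv _ _ _ _ p1 q1 t01; have {r1 s1} := conv _ _ _ _ r1 s1 t'01.
have {p2 q2} := conv _ _ _ _ p2 q2 t01; have {r2 s2} := conv _ _ _ _ r2 s2 t'01.
rewrite e1 e2; move: (r.1 + _) (r.2 + _) => x y.
rewrite !ltr_norml => /andP[? ?] /andP[? ?] /andP[? ?] /andP[? ?].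
by case: uv; rewrite ler_normr => /orP[]; lra.
Qed.

Lemma within_ball (f : K -> K * K) (a b x e : K) :
  {within `[a, b], continuous f} -> a <= x <= b -> 0 < e ->
  exists2 d : K, 0 < d &
    forall y, a <= y <= b -> `|y - x| < d -> ball (f x) e (f y).
Proof.
move=> /subspace_continuousP cf xab e0.
have : within `[a, b] (nbhs x) (f @^-1` ball (f x) e).
  by apply: cf; [rewrite /= in_itv|exact: nbhsx_ballx].
move=> /nbhs_ballP[d /= d0 fd]; exists d => // y yab yx.
by apply: fd; rewrite /= ?in_itv // /ball /= distrC.
Qed.

(** Around each pair of parameters the two values lie in disjoint boxes; compactness makes the scale
    uniform, first in the parameter of [g] and then in that of [f]. *)
Lemma arcs_scale (f g : K -> K * K) :
  {within `[0, 1], continuous f} -> {within `[0, 1], continuous g} ->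
  f @` `[0, 1] `&` g @` `[0, 1] = set0 ->
  exists2 d : K, 0 < d & forall x x' y y' : K,
    0 <= x <= 1 -> 0 <= x' <= 1 -> 0 <= y <= 1 -> 0 <= y' <= 1 ->
    `|x - x'| < d -> `|y - y'| < d ->
    segment (f x) (f x') `&` segment (g y) (g y') = set0.
Proof.
move=> cf cg fg.
have local x0 y0 : 0 <= x0 <= 1 -> 0 <= y0 <= 1 -> exists2 d : K, 0 < d &
    forall x x' y y' : K,
    0 <= x <= 1 -> 0 <= x' <= 1 -> 0 <= y <= 1 -> 0 <= y' <= 1 ->
    `|x - x0| < d -> `|x' - x0| < d -> `|y - y0| < d -> `|y' - y0| < d ->
    segment (f x) (f x') `&` segment (g y) (g y') = set0.
  move=> x0I y0I.
  have neq : f x0 != g y0.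
    apply/eqP => e; have : set0 (f x0); last by [].
    by rewrite -fg; split; [exists x0 => //|exists y0 => //]; rewrite /= in_itv.
  have [e e0 far] : exists2 e : K, 0 < e & 2 * e <= `|(f x0).1 - (g y0).1| \/
      2 * e <= `|(f x0).2 - (g y0).2|.
    have [e1|n1] := eqVneq (f x0).1 (g y0).1.
      exists (`|(f x0).2 - (g y0).2| / 2); last by right; lra.
      rewrite divr_gt0 // normr_gt0 subr_eq0; apply: contra neq => /eqP e2.
      by rewrite (surjective_pairing (f x0)) e1 e2 -surjective_pairing.
    exists (`|(f x0).1 - (g y0).1| / 2); last by left; lra.
    by rewrite divr_gt0 // normr_gt0 subr_eq0.
  have [d1 d10 fd1] := within_ball cf x0I e0.
  have [d2 d20 gd2] := within_ball cg y0I e0.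
  exists (Num.min d1 d2); first by rewrite lt_min d10.
  move=> x x' y y' xI x'I yI y'I; rewrite !lt_min.
  move=> /andP[? _] /andP[? _] /andP[_ ?] /andP[_ ?].
  by apply: (segment_disjoint far); [exact: fd1..|exact: gd2|exact: gd2].
have [|x0 x0I|d d0 Qd] := @lebesgue_number 0 1 (fun d x x' => forall y y' : K,
  0 <= y <= 1 -> 0 <= y' <= 1 -> `|y - y'| < d ->
  segment (f x) (f x') `&` segment (g y) (g y') = set0).
- move=> d e x x' _ de Q y y' yI y'I yy'.
  by apply: Q => //; exact: lt_le_trans de.
- have [|y0 y0I|d d0 Qd] := @lebesgue_number 0 1 (fun d y y' => forall x x' : K,
    0 <= x <= 1 -> 0 <= x' <= 1 -> `|x - x0| < d -> `|x' - x0| < d ->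
    segment (f x) (f x') `&` segment (g y) (g y') = set0).
  + move=> d e y y' _ de Q x x' xI x'I xx0 x'x0.
    by apply: Q => //; exact: lt_le_trans de.
  + have [d d0 Qd] := local x0 y0 x0I y0I.
    by exists d => // y y' yI y'I yy0 y'y0 x x' xI x'I xx0 x'x0; exact: Qd.
  + by exists d => // x x' xI x'I xx0 x'x0 y y' yI y'I yy'; exact: Qd.
- by exists d => // x x' y y' xI x'I yI y'I xx' yy'; exact: Qd.
Qed.

End Arcs.

(** * Nonplanarity of K33 for continuous arcs *)

Section Nonplanar.
Variable K : realType.

(** Holding for all large [n], it lets a single subdivision serve finitely many pairs of arcs. *)
Lemma arcs_grid (f g : K -> K * K) :
  {within `[0, 1], continuous f} -> {within `[0, 1], continuous g} ->
  f @` `[0, 1] `&` g @` `[0, 1] = set0 ->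
  \forall n \near \oo, forall x y : nat, (x < n.+1)%N -> (y < n.+1)%N ->
    segment (f (x%:R / n.+1%:R)) (f (x.+1%:R / n.+1%:R)) `&`
    segment (g (y%:R / n.+1%:R)) (g (y.+1%:R / n.+1%:R)) = set0.
Proof.
move=> cf cg fg; have [d d0 sep] := arcs_scale cf cg fg.
near=> n.
have nd : n.+1%:R^-1 < d by near: n; exact: (near_infty_natSinv_lt (PosNum d0)).
have unit k : (k <= n.+1)%N -> 0 <= (k%:R / n.+1%:R : K) <= 1.
  move=> kn; rewrite divr_ge0 //=.
  by rewrite ler_pdivrMr ?ltr0Sn // mul1r ler_nat.
have step k : `|(k%:R : K) / n.+1%:R - k.+1%:R / n.+1%:R| < d.
  rewrite -mulrBl -natr1 opprD addNKr normrM normrN1 mul1r.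
  by rewrite ger0_norm // invr_ge0.
by move=> x y xn yn; apply: sep => //; apply: unit => //; exact: ltnW.
Unshelve. all: by end_near. Qed.

Lemma K33_nonplanar (T : Type) (G : graph T) (A B : nat -> T) :
  {in gtn 3 &, injective A} -> {in gtn 3 &, injective B} ->
  (forall i j, (i < 3)%N -> (j < 3)%N -> A i <> B j) ->
  (forall i j, (i < 3)%N -> (j < 3)%N -> edges G [set A i; B j]) ->
  ~ planar K G.
Proof.
move=> injA injB AB edgeAB [p [D [_ arcD _ crossD]]].
(* Indices outside the range get a dummy constant path. *)
have /choice[f fP] : forall ij : nat * nat, exists f : K -> K * K,
    (ij.1 < 3)%N -> (ij.2 < 3)%N ->
    [/\ {within `[0, 1], continuous f}, f 0 = p (A ij.1), f 1 = p (B ij.2)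
      & f @` `[0, 1] = D [set A ij.1; B ij.2]].
  move=> [i j] /=; have [i3|] := ltnP i 3; last by exists (cst 0).
  have [j3|] := ltnP j 3; last by exists (cst 0).
  by have [f [cf _ f0 f1 fD]] := arcD _ _ (edgeAB _ _ i3 j3); exists f.
pose separated n i j k l := forall x y : nat, (x < n.+1)%N -> (y < n.+1)%N ->
    segment (f (i, j) (x%:R / n.+1%:R)) (f (i, j) (x.+1%:R / n.+1%:R)) `&`
    segment (f (k, l) (y%:R / n.+1%:R)) (f (k, l) (y.+1%:R / n.+1%:R)) = set0.
have : \forall n \near \oo, forall e : 'I_3 * 'I_3 * ('I_3 * 'I_3),
    e.1.1 != e.2.1 -> e.1.2 != e.2.2 -> separated n e.1.1 e.1.2 e.2.1 e.2.2.
  apply: filter_forall => -[[i j] [k l]] /=.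
  have [ik|ik] := boolP (i == k); first exact: nearW.
  have [jl|jl] := boolP (j == l); first exact: nearW.
  have [cf _ _ fD] := fP (i : nat, j : nat) (ltn_ord i) (ltn_ord j).
  have [cg _ _ gD] := fP (k : nat, l : nat) (ltn_ord k) (ltn_ord l).
  have disj : f (i : nat, j : nat) @` `[0, 1] `&`
      f (k : nat, l : nat) @` `[0, 1] = set0.
    rewrite fD gD /=; apply/seteqP; split=> // z.
    have Eij := edgeAB _ _ (ltn_ord i) (ltn_ord j).
    have Ekl := edgeAB _ _ (ltn_ord k) (ltn_ord l).
    have neqA : A i <> A k.
      by move/injA => /(_ (ltn_ord i) (ltn_ord k))/val_inj/eqP; apply/negP.
    have neqB : B j <> B l.
      by move/injB => /(_ (ltn_ord j) (ltn_ord l))/val_inj/eqP; apply/negP.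
    have ABil := AB _ _ (ltn_ord i) (ltn_ord l).
    have ABkj := AB _ _ (ltn_ord k) (ltn_ord j).
    (* Independent edges have no common end, and [crossD] allows arcs to meet only there. *)
    have apart w : [set A i; B j] w -> [set A k; B l] w -> False.
      by move=> [->|->] [] => // /esym.
    move/(crossD _ _ Eij Ekl); case=> [e|w [w1 w2] _]; last exact: (apart w).
    by apply: (apart (A i)); [left|rewrite -e; left].
  have := arcs_grid cf cg disj.
  by apply: filterS => n sep _ _.
move=> near_sep; have [n sep] := filter_ex near_sep.
apply: (@K33_crossing K (p \o A) (p \o B)
  (fun i j x => f (i, j) (x%:R / n.+1%:R)) n).
  move=> i j i3 j3; have [_ f0 f1 _] := fP (i, j) i3 j3.
  by rewrite mul0r divff ?pnatr_eq0.
move=> i j k l i3 j3 k3 l3 /eqP ik /eqP jl.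
exact: (sep ((Ordinal i3, Ordinal j3), (Ordinal k3, Ordinal l3))).
Unshelve. all: by end_near. Qed.

End Nonplanar.

(** * Ideals and the co-maximal ideal graph *)

Section Ideals.
Variable R : comNzRingType.
Implicit Types I J M : set R.

Lemma is_ideal_full I : is_ideal I -> I 1 -> I = setT.
Proof.
move=> [_ _ IM] I1; apply/seteqP; split=> // x _.
by rewrite -[x]mulr1; exact: IM.
Qed.

Lemma proper_ideal1 I : proper_ideals R I -> ~ I 1.
Proof. by move=> [idI nI] /(is_ideal_full idI). Qed.

Lemma is_ideal_sum I J : is_ideal I -> is_ideal J -> is_ideal (ideal_sum I J).
Proof.
move=> [I0 ID IM] [J0 JD JM]; split.
- by exists 0 => //; exists 0 => //; rewrite addr0.
- move=> _ _ [x Ix [y Jy <-]] [x' Ix' [y' Jy' <-]].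
  exists (x + x'); first exact: ID.
  by exists (y + y'); [exact: JD|rewrite addrACA].
- move=> a _ [x Ix [y Jy <-]]; exists (a * x); first exact: IM.
  by exists (a * y); [exact: JM|rewrite mulrDr].
Qed.

Lemma ideal_sum_setT I J x : is_ideal I -> is_ideal J -> I x -> J (1 - x) ->
  ideal_sum I J = setT.
Proof.
move=> idI idJ Ix Jx; apply: is_ideal_full; first exact: is_ideal_sum.
by exists x => //; exists (1 - x) => //; rewrite addrC subrK.
Qed.

Lemma is_ideal_principal (x : R) : is_ideal [set r * x | r in setT].
Proof.
split; first by exists 0; rewrite ?mul0r.
- by move=> _ _ [r _ <-] [s _ <-]; exists (r + s); rewrite ?mulrDl.
- by move=> a _ [r _ <-]; exists (a * r); rewrite ?mulrA.
Qed.

Lemma maximal_ideal_exists I : proper_ideals R I ->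
  exists2 M, maximal_ideals R M & I `<=` M.
Proof.
move=> [idI nI].
(* [Zorn_bigcup] also treats the empty chain, whose union is empty; adjoining [I] makes [P] hold
   there. *)
pose P X := proper_ideals R (I `|` X).
have P0 : P set0 by rewrite /P setU0.
have [F FP totF|M [PM maxM]] := @Zorn_bigcup R P.
  have FP0 X : F X \/ X = set0 -> P X by case=> [/FP|->].
  have cover x : (I `|` \bigcup_(X in F) X) x ->
      exists2 X, F X \/ X = set0 & (I `|` X) x.
    move=> [Ix|[X FX Xx]]; first by exists set0; [right|left].
    by exists X; [left|right].
  have sub X : F X \/ X = set0 -> I `|` X `<=` I `|` \bigcup_(X in F) X.
    by case=> [FX|->] x [Ix|Xx]; by [left|right; exists X].
  split; last first.
    move=> full; have [X FX] : exists2 X, F X \/ X = set0 & (I `|` X) 1.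
      by apply: cover; rewrite full.
    exact: (proper_ideal1 (FP0 X FX)).
  split; first by left; case: idI.
  - move=> x y /cover[X FX Xx] /cover[Y FY Yy].
    have [XY|YX] : X `<=` Y \/ Y `<=` X.
    + case: FX => [FX|->]; last by left.
      by case: FY => [FY|->]; [exact: totF|right].
    + apply: (sub Y FY); have [[_ + _] _] := FP0 Y FY; apply=> //.
      by case: Xx => [Ix|/XY]; [left|right].
    + apply: (sub X FX); have [[_ + _] _] := FP0 X FX; apply=> //.
      by case: Yy => [Iy|/YX]; [left|right].
  - move=> a x /cover[X FX Xx]; apply: (sub X FX).
    by have [[_ _ +] _] := FP0 X FX; apply.
exists (I `|` M); last by move=> x; left.
split=> // J [idJ nJ] IMJ.
have IJ : I `|` J = J by apply/setUidPr => x Ix; apply: IMJ; left.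
apply: contrapT => neqJ; apply: (maxM J); last by rewrite /P IJ.
split=> [x Mx|JM]; first by apply: IMJ; right.
by apply: neqJ; apply/seteqP; split=> // x Jx; right; exact: JM.
Qed.

Lemma maximal_comaximal M I : maximal_ideals R M -> is_ideal I -> ~ I `<=` M ->
  exists2 x, M x & I (1 - x).
Proof.
move=> [[idM nM] maxM] idI IM.
have [full|nfull] := pselect (ideal_sum M I = setT).
  have [x Mx [y Iy xy]] : ideal_sum M I 1 by rewrite full.
  by exists x => //; rewrite -xy addrC addKr.
exfalso; apply: IM => x Ix.
have <- : ideal_sum M I = M.
  apply: maxM; first by split=> //; exact: is_ideal_sum.
  by move=> y My; exists y => //; exists 0; [case: idI|rewrite addr0].
by exists 0; [case: idM|exists x => //; rewrite add0r].
Qed.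

(** A maximal ideal above [J] would also contain [I] if [I] were in the Jacobson radical, and then
    it would contain 1. *)
Lemma comaximal_vertex I J : proper_ideals R I -> proper_ideals R J ->
  ideal_sum I J = setT -> comaximal_vertices R I.
Proof.
move=> pI pJ IJ; split=> // IR.
have [M maxM JM] := maximal_ideal_exists pJ.
have [[[M0 MD _] _] _] := maxM.
apply: (@proper_ideal1 M (proj1 maxM)).
have [x Ix [y Jy <-]] : ideal_sum I J 1 by rewrite IJ.
by apply: MD; [exact: IR|exact: JM].
Qed.

Lemma comaximal_edge I J : proper_ideals R I -> proper_ideals R J ->
  ideal_sum I J = setT -> comaximal_edges R [set I; J].
Proof.
move=> pI pJ IJ; exists I, J; split=> //.
- split; first exact: comaximal_vertex IJ.
  apply: (comaximal_vertex pJ pI); rewrite -IJ.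
  by apply/seteqP; split=> _ [x Jx [y Iy <-]]; exists y => //; exists x => //;
    rewrite addrC.
- move=> eIJ; apply: (proper_ideal1 pJ).
  have [x Jx [y Jy <-]] : ideal_sum J J 1 by rewrite -{1}eIJ IJ.
  by case: pJ => -[_ + _] _; apply.
Qed.

End Ideals.

(** Since [e] and [1 - e] add up to 1, every [A i] is comaximal to every [B j]. *)
Lemma K33_comaximal_nonplanar (K : realType) (R : comNzRingType) (e : R)
    (A B : nat -> set R) :
  (forall i, (i < 3)%N -> proper_ideals R (A i) /\ A i e) ->
  (forall i, (i < 3)%N -> proper_ideals R (B i) /\ B i (1 - e)) ->
  {in gtn 3 &, injective A} -> {in gtn 3 &, injective B} ->
  ~ planar K (comaximal_graph R).
Proof.
move=> idA idB injA injB.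
apply: (K33_nonplanar injA injB) => i j /idA[pA Ae] /idB[pB Be].
  move=> eAB; apply: (proper_ideal1 pB).
  rewrite -(subrKC e 1).
  by case: (pB) => -[_ + _] _; apply=> //; rewrite -eAB.
apply: comaximal_edge => //.
by case: pA pB => idAi _ [idBj _]; exact: ideal_sum_setT Ae Be.
Qed.

(* The ring [e R], whose unit is the nonzero idempotent [e]. *)
Section Corner.
Variables (R : comNzRingType) (e : R).

Record corner (idem : e * e = e) (nz : e != 0) : Type :=
  Corner { corner_val : R; _ : e * corner_val == corner_val }.

Hypotheses (idem : e * e = e) (nz : e != 0).
Local Notation S := (corner idem nz).

HB.instance Definition _ := [isSub for @corner_val idem nz].
HB.instance Definition _ := [Choice of S by <:].

Lemma corner_val_inj : injective (@corner_val idem nz).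
Proof. exact: val_inj. Qed.

Lemma mul_corner (x : S) : e * corner_val x = corner_val x.
Proof. by case: x => x /= /eqP. Qed.

Fact corner_proj_subproof x : e * (e * x) == e * x.
Proof. by rewrite mulrA idem. Qed.

Definition corner_proj x : S := @Corner idem nz (e * x) (corner_proj_subproof x).

Lemma corner_projK (x : S) : corner_proj (corner_val x) = x.
Proof. by apply: corner_val_inj; rewrite /= mul_corner. Qed.

(** Applying [corner_proj] to each result replaces separate closure proofs. *)
Definition corner_zero := corner_proj 0.
Definition corner_opp (x : S) := corner_proj (- corner_val x).
Definition corner_add (x y : S) := corner_proj (corner_val x + corner_val y).
Definition corner_one := corner_proj 1.
Definition corner_mul (x y : S) := corner_proj (corner_val x * corner_val y).

Fact corner_addA : associative corner_add.
Proof.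
by move=> x y z; apply: corner_val_inj; rewrite /= !mulrDr !mul_corner addrA.
Qed.

Fact corner_addC : commutative corner_add.
Proof. by move=> x y; apply: corner_val_inj; rewrite /= addrC. Qed.

Fact corner_add0 : left_id corner_zero corner_add.
Proof.
by move=> x; apply: corner_val_inj; rewrite /= mulr0 add0r mul_corner.
Qed.

Fact corner_addN : left_inverse corner_zero corner_opp corner_add.
Proof.
by move=> x; apply: corner_val_inj; rewrite /= mulrN mul_corner addNr.
Qed.

HB.instance Definition _ := GRing.isZmodule.Build S
  corner_addA corner_addC corner_add0 corner_addN.

Fact corner_mulA : associative corner_mul.
Proof.
move=> x y z; apply: corner_val_inj.
by rewrite /= [corner_val x * _]mulrCA !mulrA.
Qed.

Fact corner_mulC : commutative corner_mul.
Proof.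
by move=> x y; apply: corner_val_inj; rewrite /= [corner_val x * _]mulrC.
Qed.

Fact corner_mul1 : left_id corner_one corner_mul.
Proof. by move=> x; apply: corner_val_inj; rewrite /= mulr1 !mul_corner. Qed.

Fact corner_mulD : left_distributive corner_mul corner_add.
Proof.
by move=> x y z; apply: corner_val_inj; rewrite /= -mulrDr -mulrDl !mulrA.
Qed.

Fact corner_one_neq0 : corner_one != 0.
Proof.
apply: contraNneq nz => /(congr1 (@corner_val idem nz)).
by rewrite /= mulr1 mulr0 => ->.
Qed.

HB.instance Definition _ := GRing.Zmodule_isComNzRing.Build S
  corner_mulA corner_mulC corner_mul1 corner_mulD corner_one_neq0.

Fact corner_proj_zmod : zmod_morphism corner_proj.
Proof.
move=> x y; apply: corner_val_inj.
by rewrite /= !(mulrDr, mulrN, mulrA) !idem.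
Qed.

Fact corner_proj_monoid : monoid_morphism corner_proj.
Proof.
split=> // x y; apply: corner_val_inj.
by rewrite /= mulrACA idem [RHS]mulrA idem.
Qed.

HB.instance Definition _ :=
  GRing.isZmodMorphism.Build R S corner_proj corner_proj_zmod.
HB.instance Definition _ :=
  GRing.isMonoidMorphism.Build R S corner_proj corner_proj_monoid.

Lemma corner_proj_surj (y : S) : exists x, corner_proj x = y.
Proof. by exists (corner_val y); exact: corner_projK. Qed.

End Corner.

Section PairMorphism.
Variables (R S T : comNzRingType).
Variables (f : {rmorphism R -> S}) (g : {rmorphism R -> T}).

Definition pair_map (x : R) : S * T := (f x, g x).

Fact pair_map_zmod : zmod_morphism pair_map.
Proof. by move=> x y; rewrite /pair_map !rmorphB. Qed.

Fact pair_map_monoid : monoid_morphism pair_map.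
Proof. by split=> [|x y]; rewrite /pair_map ?rmorph1 ?rmorphM. Qed.

HB.instance Definition _ :=
  GRing.isZmodMorphism.Build R (S * T)%type pair_map pair_map_zmod.
HB.instance Definition _ :=
  GRing.isMonoidMorphism.Build R (S * T)%type pair_map pair_map_monoid.

End PairMorphism.

Lemma card_le_I1 T (X : set T) :
  (forall x y, X x -> X y -> x = y) -> X #<= `I_1.
Proof.
move=> X1; have [->|/set0P[x Xx]] := eqVneq X set0; first exact: card_ge0.
have -> : X = [set x] by apply/seteqP; split=> [y Xy|_ ->//]; exact: X1.
by rewrite (card_le_eql card_set1) card_lexx.
Qed.

Definition few_ideals (S : comNzRingType) :=
  forall I J, nontrivial_ideals S I -> nontrivial_ideals S J -> I = J.

Lemma ideals_le_I3 (S : comNzRingType) : few_ideals S -> ideals S #<= `I_3.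
Proof.
move=> one.
have [I oneI] : exists I, forall J, nontrivial_ideals S J -> J = I.
  have [->|/set0P[I nI]] := eqVneq (nontrivial_ideals S) set0.
    by exists set0.
  by exists I => J nJ; exact: one.
apply: (card_le_trans (B := nth setT [:: [set 0]; setT; I] @` `I_3)).
  apply: subset_card_le => J idJ.
  have [->|J0] := pselect (J = [set 0]); first by exists 0%N.
  have [->|JT] := pselect (J = setT); first by exists 1%N.
  by exists 2%N => //=; apply/esym/oneI.
exact: card_image_le.
Qed.

Lemma proper_ideal0 (S : comNzRingType) : proper_ideals S [set 0].
Proof.
split; first by split=> // [x y ->->|a x ->]; [exact: addr0|exact: mulr0].
move=> full; have : [set (0 : S)] 1 by rewrite full.
by move/eqP; rewrite oner_eq0.
Qed.

(** * Ideals along a surjective morphism *)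

Section Surjection.
Variables (R S : comNzRingType) (f : {rmorphism R -> S}).
Hypothesis surj_f : forall y, exists x, f x = y.

Lemma is_ideal_preimage I : is_ideal I -> is_ideal (f @^-1` I).
Proof.
move=> [I0 ID IM]; split => [|x y Ix Iy|a x Ix]; rewrite /preimage /=.
- by rewrite rmorph0.
- by rewrite rmorphD; exact: ID.
- by rewrite rmorphM; exact: IM.
Qed.

Lemma proper_ideal_preimage I : proper_ideals S I -> proper_ideals R (f @^-1` I).
Proof.
move=> pI; split; first by apply: is_ideal_preimage; case: pI.
move=> full; apply: (proper_ideal1 pI).
have : (f @^-1` I) 1 by rewrite full.
by rewrite /preimage /= rmorph1.
Qed.

Lemma preimage_ideal_inj : injective (fun I : set S => f @^-1` I).
Proof.
move=> I J IJ; apply/seteqP; split=> y; have [x <-] := surj_f y => fx.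
  by have : (f @^-1` I) x by []; rewrite IJ.
by have : (f @^-1` J) x by []; rewrite -IJ.
Qed.

Lemma is_ideal_image I : is_ideal I -> is_ideal (f @` I).
Proof.
move=> [I0 ID IM]; split; first by exists 0; rewrite ?rmorph0.
- by move=> _ _ [x Ix <-] [y Iy <-]; exists (x + y); [exact: ID|rewrite rmorphD].
- move=> b _ [x Ix <-]; have [a <-] := surj_f b.
  by exists (a * x); [exact: IM|rewrite rmorphM].
Qed.

(** An ideal [I] above the preimage contains the kernel, so its image stays proper and equals [N] by
    maximality. *)
Lemma maximal_ideal_preimage N : maximal_ideals S N ->
  maximal_ideals R (f @^-1` N).
Proof.
move=> [pN maxN]; split; first exact: proper_ideal_preimage.
move=> I pI NI; have [idI _] := pI; have [[N0 ND NM] _] := pN.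
have fI : f @` I = N.
  apply: maxN.
    split; first exact: is_ideal_image.
    move=> full; have [x Ix fx] : (f @` I) 1 by rewrite full.
    apply: (proper_ideal1 pI); rewrite -(subrKC x 1).
    have [_ ID _] := idI; apply: ID => //; apply: NI.
    by rewrite /preimage /= rmorphB rmorph1 fx subrr.
  move=> y Ny; have [x fx] := surj_f y.
  by exists x => //; apply: NI; rewrite /preimage /= fx.
by apply/seteqP; split=> // x Ix; rewrite /preimage /= -fI; exists x.
Qed.

(** Preimages embed the maximal ideals of [S] into those of [R] containing the kernel. *)
Lemma is_local_surjection (M : set R) :
  (forall N, maximal_ideals R N -> (forall x, f x = 0 -> N x) -> N = M) ->
  is_local S.
Proof.
move=> uniqM.
have [N0 maxN0 _] : exists2 N, maximal_ideals S N & [set 0] `<=` N.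
  exact/maximal_ideal_exists/proper_ideal0.
have pre N : maximal_ideals S N -> f @^-1` N = M.
  move=> maxN; apply: uniqM; first exact: maximal_ideal_preimage.
  by move=> x fx; rewrite /preimage /= fx; case: maxN => -[[]].
rewrite /is_local (_ : maximal_ideals S = [set N0]).
  exact: card_set1.
apply/seteqP; split=> [N maxN|_ ->//].
by apply: preimage_ideal_inj; rewrite !pre.
Qed.

End Surjection.

(** * Idempotents from the finiteness of the graph *)

Lemma idempotent_separation (R : comNzRingType) (M M' : set R) :
  finite_set (comaximal_vertices R) -> maximal_ideals R M ->
  maximal_ideals R M' -> M <> M' ->
  exists e, [/\ e * e = e, M e & M' (1 - e)].
Proof.
move=> finV maxM maxM' neqM.
have [pM _] := maxM; have [[idM' nM'] maxM'P] := maxM'.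
have [idM _] := pM; have [_ _ MM] := idM; have [M'0 M'D M'M] := idM'.
have [a Ma M'a] : exists2 a, M a & M' (1 - a).
  apply: maximal_comaximal => // sub; apply: neqM.
  by apply: maxM'P.
(* [1 - a] divides [1 - a ^+ n]. Hence no power of [a] is in [M'], nor in the Jacobson radical. *)
have M'pow n : M' (1 - a ^+ n).
  by rewrite -(expr1n _ n) subrXX mulrC; exact: M'M.
pose powers n := [set r * a ^+ n.+1 | r in setT].
have vertex n : comaximal_vertices R (powers n).
  split.
    split; first exact: is_ideal_principal.
    move=> full; apply: (proper_ideal1 pM).
    have [r _ <-] : powers n 1 by rewrite full.
    by rewrite exprSr mulrA; exact: MM.
  move=> sub; apply: (@proper_ideal1 R M') => //.
  rewrite -(subrKC (a ^+ n.+1) 1); apply: M'D => //.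
  by apply: sub => //; exists 1 => //; rewrite mul1r.
(* A sequence of vertices of a finite graph takes some value twice. *)
have [i [m [r]]] : exists i m r, a ^+ i.+1 = r * a ^+ (i.+1 + m.+1).
  have [/asboolP|] := boolP `[< exists i j, (i < j)%N /\ powers i = powers j >].
    move=> [i [j [ij eij]]].
    have [r _ rE] : powers j (a ^+ i.+1) by rewrite -eij; exists 1; rewrite ?mul1r.
    by exists i, (j - i.+1)%N, r; rewrite addnS subnKC // rE.
  move=> /asboolPn inj; exfalso; apply: infinite_nat.
  rewrite (_ : setT = powers @^-1` comaximal_vertices R); last first.
    by apply/seteqP; split=> // n _; exact: vertex.
  apply: finite_preimage finV => i j _ _ eij.
  by have [ij|ij|//] := ltngtP i j; exfalso; apply: inj; [exists i, j|exists j, i].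
have : M (a ^+ i.+1) by rewrite exprSr; exact: MM.
move: (i.+1) => n Man aE.
have powE k : a ^+ n = r ^+ k * a ^+ (n + m.+1 * k).
  elim: k => [|k ih]; first by rewrite mul1r muln0 addn0.
  by rewrite mulnS [(m.+1 + _)%N]addnC addnA exprD exprS -mulrA [X in r * X]mulrA
    -ih -exprD.
(* Iterating [n] times raises the exponent from [n] to at least [2 * n], so that [s * a ^+ n] is
   idempotent. *)
have [s sE] : exists s, a ^+ n = s * a ^+ n * a ^+ n.
  exists (r ^+ n * a ^+ (m * n)); rewrite {1}(powE n) mulSn !exprD.
  by rewrite -!mulrA; congr (_ * _); rewrite mulrA mulrC.
exists (s * a ^+ n); split.
- by rewrite mulrCA -sE.
- exact: MM.
- have -> : 1 - s * a ^+ n = (1 - s * a ^+ n) * (1 - a ^+ n).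
    by rewrite mulrBr mulr1 mulrBl mul1r -sE subrr subr0.
  exact: M'M.
Qed.

(** * Factors with two nontrivial ideals *)

Section Factors.
Variables (K : realType) (R : comNzRingType).
Implicit Types e f : R.
Hypothesis planarR : planar K (comaximal_graph R).

(** Zero and two nontrivial ideals are pulled back along the projection, whose kernel contains
    [1 - e]. *)
Lemma three_ideals e (ee : e * e = e) (e0 : e != 0 :> R) :
  ~ few_ideals (corner ee e0) -> exists A : nat -> set R,
    (forall i, (i < 3)%N -> proper_ideals R (A i) /\ A i (1 - e)) /\
    {in gtn 3 &, injective A}.
Proof.
move=> many.
have [I [J [[idI nI0 nI] [idJ nJ0 nJ] neqIJ]]] : exists I J,
    [/\ nontrivial_ideals (corner ee e0) I,
        nontrivial_ideals (corner ee e0) J & I <> J].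
  apply: contrapT => none; apply: many => I J nI nJ.
  by apply: contrapT => neqIJ; apply: none; exists I, J.
pose X := nth setT [:: [set 0]; I; J].
have pX i : (i < 3)%N -> proper_ideals (corner ee e0) (X i).
  by case: i => [|[|[|//]]] _; [exact: proper_ideal0|split..].
exists (fun i => corner_proj ee e0 @^-1` X i); split=> [i i3|i j i3 j3].
  split; first exact/proper_ideal_preimage/pX.
  rewrite /preimage /= (_ : corner_proj ee e0 (1 - e) = 0).
    by have [[]] := pX i i3.
  by apply: corner_val_inj; rewrite /= mulrBr mulr1 ee subrr mulr0.
move/(preimage_ideal_inj (corner_proj_surj (idem := ee) (nz := e0))).
move: i3 j3; case: i => [|[|[|//]]] _; case: j => [|[|[|//]]] _ //= XX.
- by case: nI0; exact/esym.
- by case: nJ0; exact/esym.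
- by case: neqIJ; exact/esym.
Qed.

Lemma is_ideal_annihilator (x : R) : is_ideal [set y | x * y = 0].
Proof.
split=> [|y z /= xy xz|a y /= xy]; first exact: mulr0.
- by rewrite mulrDr xy xz addr0.
- by rewrite mulrCA xy mulr0.
Qed.

(** Otherwise three ideals containing [1 - f1] face the annihilators of [f2], [f3] and [f2 + f3],
    which contain [f1], and form K33 with them. *)
Lemma planar_triple f1 f2 f3 (ff1 : f1 * f1 = f1) (nz1 : f1 != 0) :
  f2 * f2 = f2 -> f3 * f3 = f3 -> f2 != 0 -> f3 != 0 ->
  f2 * f1 = 0 -> f3 * f1 = 0 -> f2 * f3 = 0 ->
  few_ideals (corner ff1 nz1).
Proof.
move=> ff2 ff3 nz2 nz3 f21 f31 f23; apply: contrapT => many.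
have [A [idA injA]] := three_ideals many.
pose x := nth 0 [:: f2; f3; f2 + f3].
apply: (K33_comaximal_nonplanar idA (B := fun i => [set y | x i * y = 0])
  _ injA _ planarR).
  move=> i i3; have xx : x i * x i = x i.
    by case: i i3 => [|[|[|//]]] _ //=;
      rewrite mulrDl !mulrDr ff2 ff3 (mulrC f3) f23 addr0 add0r.
  have x0 : x i != 0.
    case: i i3 {xx} => [|[|[|//]]] _ //; apply/eqP; rewrite /x /= => f230.
    case/eqP: nz2; rewrite -ff2 -[f2 * f2]addr0 -[X in _ + X]f23.
    by rewrite -mulrDr f230 mulr0.
  rewrite subKr; split.
    split; first exact: is_ideal_annihilator.
    move=> full; case/eqP: x0; rewrite -[x i]mulr1.
    by have : [set y | x i * y = 0] 1 by rewrite full.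
  by case: i i3 {xx x0} => [|[|[|//]]] _ //=; rewrite mulrDl f21 f31 addr0.
(* Membership of [f2] and [f3] tells the three annihilators apart. *)
pose B := fun i => [set y | x i * y = 0].
have B3 : B 0%N f3 /\ ~ B 1%N f3 /\ ~ B 2%N f3.
  rewrite /B /= mulrDl ff3 f23 add0r.
  by split=> //; split; apply/eqP.
have B2 : ~ B 0%N f2 /\ B 1%N f2 /\ ~ B 2%N f2.
  rewrite /B /= mulrDl ff2 (mulrC f3) f23 addr0.
  by split; [apply/eqP|split=> //; apply/eqP].
move=> i j i3 j3; rewrite -[LHS]/(B i) -[RHS]/(B j) => eB.
have := B2; have := B3.
move: i3 j3 eB; case: i => [|[|[|//]]] _; case: j => [|[|[|//]]] _ // eB;
  by rewrite eB; tauto.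
Qed.

End Factors.

(** * Product decompositions from orthogonal idempotents *)

Lemma mul_corner_eq0 (R : comNzRingType) (a e : R) (ee : e * e = e)
    (e0 : e != 0) (x : corner ee e0) : a * e = 0 -> a * corner_val x = 0.
Proof. by move=> ae; rewrite -(mul_corner x) mulrA ae mul0r. Qed.

Lemma corner_pair_isomorphic (R : comNzRingType) (e f : R)
    (ee : e * e = e) (ff : f * f = f) (e0 : e != 0) (f0 : f != 0) :
  e * f = 0 -> e + f = 1 ->
  ring_isomorphic R (corner ee e0 * corner ff f0)%type.
Proof.
move=> ef e1.
exists (pair_map (corner_proj ee e0) (corner_proj ff f0)).
exists (fun z => corner_val z.1 + corner_val z.2) => [x|[y z]] /=.
  by rewrite -mulrDl e1 mul1r.
congr pair; apply: corner_val_inj; rewrite /= mulrDr mul_corner.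
  by rewrite mul_corner_eq0 ?addr0.
by rewrite mul_corner_eq0 ?add0r // mulrC.
Qed.

Lemma corner_triple_isomorphic (R : comNzRingType) (e f g : R)
    (ee : e * e = e) (ff : f * f = f) (gg : g * g = g)
    (e0 : e != 0) (f0 : f != 0) (g0 : g != 0) :
  e * f = 0 -> e * g = 0 -> f * g = 0 -> e + f + g = 1 ->
  ring_isomorphic R (corner ee e0 * corner ff f0 * corner gg g0)%type.
Proof.
move=> ef eg fg e1.
exists (pair_map (pair_map (corner_proj ee e0) (corner_proj ff f0))
  (corner_proj gg g0)).
exists (fun z => corner_val z.1.1 + corner_val z.1.2 + corner_val z.2)
  => [x|[[y z] t]] /=.
  by rewrite -!mulrDl e1 mul1r.
have fe : f * e = 0 by rewrite mulrC.
have ge : g * e = 0 by rewrite mulrC.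
have gf : g * f = 0 by rewrite mulrC.
by congr (_, _, _); apply: corner_val_inj; rewrite /= !mulrDr mul_corner
  !mul_corner_eq0 ?addr0 ?add0r.
Qed.



Theorem theorem5 (K : realType) (R : comNzRingType)
    (nonempty_graph : vertices (comaximal_graph R) !=set0)
    (finite_comaximal_graph : finite_graph (comaximal_graph R))
    (planar_comaximal_graph : planar K (comaximal_graph R)) :
  (exists R1 R2 : comNzRingType,
     [/\ ring_isomorphic R (R1 * R2)%type, is_local R1, is_local R2
       & ideals R1 #<= `I_3 \/ ideals R2 #<= `I_3])
  \/
  (exists R1 R2 R3 : comNzRingType,
     [/\ ring_isomorphic R (R1 * R2 * R3)%type,
         nontrivial_ideals R1 #<= `I_1,
         nontrivial_ideals R2 #<= `I_1
       & nontrivial_ideals R3 #<= `I_1]).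
Proof.
have [I [pI IJ]] := nonempty_graph.
have [M maxM IM] := maximal_ideal_exists pI.
(* The vertex [I] lies in [M] but not in the Jacobson radical. *)
have [M' maxM' neqM] : exists2 M', maximal_ideals R M' & M <> M'.
  apply: contrapT => none; apply: IJ => x Ix M' maxM'.
  have [<-|neqM] := pselect (M = M'); first exact: IM.
  by exfalso; apply: none; exists M'.
have sep := idempotent_separation finite_comaximal_graph.
have nil1 N x : maximal_ideals R N -> N x -> N (1 - x) -> False.
  move=> maxN Nx Nx'; apply: (proper_ideal1 (proj1 maxN)).
  by rewrite -(subrKC x 1); case: maxN => -[[_ + _] _] _; apply.
have mulN N a x : maximal_ideals R N -> N x -> N (a * x).
  by case=> -[[_ _ +] _] _; apply.
have [e [ee Me Me']] := sep _ _ maxM maxM' neqM.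
have [[M'' maxM'' [neqM' neqM'']]|two] := pselect (exists2 M'',
    maximal_ideals R M'' & M <> M'' /\ M' <> M'').
- right.
  have [f [ff Mf Mf'']] := sep _ _ maxM maxM'' neqM'.
  have [g [gg Mg' Mg'']] := sep _ _ maxM' maxM'' neqM''.
  (* These are orthogonal idempotents with sum 1, nonzero because [f1], [f2], [f3] are congruent to
     1 modulo [M], [M'], [M''] respectively. *)
  pose f1 := (1 - e) * (1 - f).
  pose f2 := (1 - f1) * (1 - g); pose f3 := (1 - f1) * g.
  have idem1 (x : R) : x * x = x -> (1 - x) * (1 - x) = 1 - x.
    by move=> xx; rewrite mulrBr mulr1 mulrBl mul1r xx subrr subr0.
  have idemM (x y : R) : x * x = x -> y * y = y -> x * y * (x * y) = x * y.
    by move=> xx yy; rewrite mulrACA xx yy.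
  have ff1 : f1 * f1 = f1 by apply: idemM; exact: idem1.
  have ff2 : f2 * f2 = f2 by apply: idemM; exact: idem1.
  have ff3 : f3 * f3 = f3 by apply: idemM => //; exact: idem1.
  have M'f1 : M' f1 by rewrite /f1 mulrC; exact: mulN.
  have M''f1 : M'' f1 by exact: mulN.
  have Mf1 : M (1 - f1).
    rewrite (_ : 1 - f1 = e + (1 - e) * f); last by rewrite /f1; ring.
    have := mulN _ (1 - e) _ maxM Mf.
    by case: (maxM) => -[[_ + _] _] _; apply.
  have f11 : f1 * (1 - f1) = 0 by rewrite mulrBr mulr1 ff1 subrr.
  have gg1 : (1 - g) * g = 0 by rewrite mulrBl mul1r gg subrr.
  have f12 : f1 * f2 = 0 by rewrite /f2 mulrA f11 mul0r.
  have f13 : f1 * f3 = 0 by rewrite /f3 mulrA f11 mul0r.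
  have f23 : f2 * f3 = 0 by rewrite /f2 /f3 mulrACA gg1 mulr0.
  have nz1 : f1 != 0.
    apply/eqP => z; apply: (proper_ideal1 (proj1 maxM)).
    by rewrite -[1]subr0 -z.
  have nz2 : f2 != 0.
    apply/eqP => z; apply: (nil1 M' g) => //.
    rewrite (_ : 1 - g = (1 - g) * f1 + f2); last by rewrite /f2; ring.
    by rewrite z addr0; exact: mulN.
  have nz3 : f3 != 0.
    apply/eqP => z; apply: (nil1 M'' g) => //.
    rewrite (_ : g = g * f1 + f3); last by rewrite /f3; ring.
    by rewrite z addr0; exact: mulN.
  exists (corner ff1 nz1), (corner ff2 nz2), (corner ff3 nz3); split.
  + by apply: corner_triple_isomorphic => //; rewrite /f2 /f3; ring.
  + apply: card_le_I1; apply: (planar_triple planar_comaximal_graph ff2 ff3)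
      => //.
      by rewrite mulrC.
    by rewrite mulrC.
  + apply: card_le_I1; apply: (planar_triple planar_comaximal_graph ff1 ff3)
      => //.
    by rewrite mulrC.
  + by apply: card_le_I1; apply: (planar_triple planar_comaximal_graph ff1 ff2).
left.
have ff : (1 - e) * (1 - e) = 1 - e.
  by rewrite mulrBr mulr1 mulrBl mul1r ee subrr subr0.
have e0 : e != 0.
  by apply/eqP => z; apply: (proper_ideal1 (proj1 maxM')); rewrite -[1]subr0 -z.
have f0 : 1 - e != 0.
  by apply/eqP => z; apply: (proper_ideal1 (proj1 maxM)); rewrite (subr0_eq z).
have onlytwo N : maximal_ideals R N -> N = M \/ N = M'.
  move=> maxN; apply: contrapT => neq; apply: two; exists N => //.
  by split=> eN; apply: neq; [left|right].
exists (corner ee e0), (corner ff f0); split.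
- apply: corner_pair_isomorphic; first by rewrite mulrBr mulr1 ee subrr.
  by rewrite addrC subrK.
(* A maximal ideal above the kernel contains [1 - e], which excludes [M], where [e] lies. *)
- apply: (is_local_surjection (@corner_proj_surj _ _ ee e0) (M := M'))
    => N maxN kerN.
  have Ne : N (1 - e).
    by apply: kerN; apply: corner_val_inj; rewrite /= mulrBr mulr1 ee subrr mulr0.
  case: (onlytwo N maxN) => // NM; exfalso.
  by apply: (nil1 N e) => //; rewrite NM.
- apply: (is_local_surjection (@corner_proj_surj _ _ ff f0) (M := M))
    => N maxN kerN.
  have Ne : N e.
    by apply: kerN; apply: corner_val_inj; rewrite /= mulrBl mul1r ee subrr mulr0.
  case: (onlytwo N maxN) => // NM; exfalso.
  by apply: (nil1 N e) => //; rewrite NM.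
have [few|many] := pselect (few_ideals (corner ee e0)).
  by left; exact: ideals_le_I3.
have [few|many'] := pselect (few_ideals (corner ff f0)).
  by right; exact: ideals_le_I3.
(* The [A i] contain [1 - e] and the [B j] contain [1 - (1 - e)]. *)
exfalso; have [A [idA injA]] := three_ideals many.
have [B [idB injB]] := three_ideals many'.
exact: (K33_comaximal_nonplanar idA idB injA injB planar_comaximal_graph).
Qed.
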